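(* Let $\mathbb{D}=\{(x,-x):x\in\mathbb{R}\}$ be the anti-diagonal of the Sorgenfrey plane $\mathbb{S}^2$. For a set $E\subseteq\mathbb{D}$ the following conditions are equivalent: (1) $E$ is $C$-embedded in $\mathbb{S}^2$; (2) $E$ is $C^*$-embedded in $\mathbb{S}^2$; (3) $E$ is countable and is a $G_\delta$-subset of $\mathbb{R}^2$ (with the Euclidean topology); (4) $E$ is countable and is functionally closed in $\mathbb{S}^2$.
   Context: The Sorgenfrey line $\mathbb{S}$ is the set of real numbers with the topology generated by the half-open intervals $[a,b)$; the Sorgenfrey plane $\mathbb{S}^2$ is $\mathbb{S}\times\mathbb{S}$ with the product topology. The spaces $\mathbb{S}^2$ and $\mathbb{R}^2$ have the same underlying set. A subspace $E$ of a topological space $X$ is $C$-embedded (respectively $C^*$-embedded) in $X$ if every continuous (respectively bounded continuous) function $f:E\to\mathbb{R}$ extends to a continuous real-valued function on $X$. A subset $A$ of $X$ is functionally closed in $X$ if there is a continuous function $f:X\to[0,1]$ with $A=f^{-1}(0)$. ''Countable'' means at most countable (finite sets included). *)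

(* Defs.v *)
From HB Require Import structures.
From mathcomp Require Import all_boot all_order all_algebra.
From mathcomp Require Import all_classical all_reals all_analysis.
From mathcomp Require Import borel_hierarchy.
Set Implicit Arguments.
Unset Strict Implicit.
Unset Printing Implicit Defensive.
Import Order.TTheory GRing.Theory Num.Theory.
Import numFieldNormedType.Exports.
Local Open Scope classical_set_scope.
Local Open Scope ring_scope.

(* An alias of R: it carries the Sorgenfrey topology, while R itself keeps the
   Euclidean one. As the two types are convertible, a set of pairs of reals can
   be seen both in the plane R * R and in sorgenfrey R * sorgenfrey R. *)
Definition sorgenfrey (R : realType) : Type := R.

Section SorgenfreyTopology.
Variable R : realType.

Let half_open (ab : R * R) : set (sorgenfrey R) := `[ab.1, ab.2[%classic.

Let half_open_cover : \bigcup_(ab in setT) half_open ab = setT.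
Proof.
apply/seteqP; split => // x _; exists (x : R, (x : R) + 1) => //.
by rewrite /half_open /= in_itv /= lexx ltrDl ltr01.
Qed.

Let half_open_join (i j : R * R) (t : sorgenfrey R) :
  setT i -> setT j -> half_open i t -> half_open j t ->
  exists k, [/\ setT k, half_open k t & half_open k `<=` half_open i `&` half_open j].
Proof.
move=> _ _; rewrite /half_open /= !in_itv /= => /andP[i1 i2] /andP[j1 j2].
exists (Num.max i.1 j.1, Num.min i.2 j.2); split => //=.
  by rewrite in_itv /= ge_max lt_min i1 i2 j1 j2.
move=> x /=; rewrite !in_itv /= ge_max lt_min.
by move=> /andP[/andP[-> ->] /andP[-> ->]].
Qed.

HB.instance Definition _ := Choice.copy (sorgenfrey R) R.
HB.instance Definition _ := Pointed.copy (sorgenfrey R) R.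
HB.instance Definition _ :=
  isBaseTopological.Build (sorgenfrey R) half_open_cover half_open_join.

Lemma sorgenfrey_nbhsP (x : sorgenfrey R) (A : set (sorgenfrey R)) :
  nbhs x A <-> exists2 b : R, (x : R) < b & `[(x : R), b[%classic `<=` A.
Proof.
split.
- case=> B [[D _ <-] [i Di ix]] BA.
  have {}ix : half_open i x := ix.
  move: ix; rewrite /half_open /= in_itv /= => /andP[ix xi].
  exists i.2 => // y.
  rewrite /= in_itv /= => /andP[xy yi]; apply: BA; exists i => //.
  suff : half_open i y by [].
  by rewrite /half_open /= in_itv /= (le_trans ix xy).
- move=> [b xb bA]; exists `[(x : R), b[%classic; split => //.
    by exists [set ((x : R), b)] => //; rewrite bigcup_set1.
  by rewrite /= in_itv /= lexx.
Qed.

End SorgenfreyTopology.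

Definition sorgenfrey_plane (R : realType) : topologicalType :=
  (sorgenfrey R * sorgenfrey R)%type.

Definition euclidean_plane (R : realType) : topologicalType := (R * R)%type.

Definition antidiagonal (R : realType) : set (R * R) :=
  [set (x, - x) | x in [set: R]].

(* A function E -> R is represented by a function on X, of which only the
   restriction to E matters. *)
Definition C_embedded (R : realType) (X : topologicalType) (E : set X) :=
  forall f : X -> R, {within E, continuous f} ->
    exists2 g : X -> R, continuous g & {in E, g =1 f}.

Definition Cstar_embedded (R : realType) (X : topologicalType) (E : set X) :=
  forall f : X -> R, {within E, continuous f} -> [bounded f x | x in E] ->
    exists2 g : X -> R, continuous g & {in E, g =1 f}.

Definition functionally_closed (R : realType) (X : topologicalType)
    (A : set X) :=
  exists f : X -> R, [/\ continuous f, range f `<=` `[0, 1]%classic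
    & A = f @^-1` [set 0]].

Arguments antidiagonal R : clear implicits.
Arguments C_embedded R X E : clear implicits.
Arguments Cstar_embedded R X E : clear implicits.
Arguments functionally_closed R X A : clear implicits.

(* Main.v *)
Require Import Defs.
From mathcomp Require Import all_boot all_order all_algebra.
From mathcomp Require Import all_classical all_reals all_analysis.
From mathcomp Require Import borel_hierarchy lra zify.
Import Order.TTheory GRing.Theory Num.Theory.
Import numFieldNormedType.Exports.
Local Open Scope classical_set_scope.
Local Open Scope ring_scope.

Set Implicit Arguments.
Unset Strict Implicit.
Unset Printing Implicit Defensive.

(** Write a point of the antidiagonal as [(x, - x)] and let [A] be the set of
    reals [x] with [(x, - x)] in [E]. The half-open square with lower left
    corner [(x, - x)] touches the antidiagonal only at that corner, so the
    antidiagonal is discrete in the Sorgenfrey plane and every function on [E]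
    is continuous. The question is thus which functions on [A] are traces
    [x |-> f (x, - x)] of continuous [f], and the link with the Euclidean
    topology is that the squares at [(x, - x)] and [(y, - y)] meet as soon as
    [|x - y|] is smaller than both sides.

    Necessity. Continuity of [f] gives, for each [eta > 0], a positive gauge [d]
    on the line such that [|x - y| < min (d x) (d y)] forces the traces at [x]
    and [y] to be [eta]-close ([continuous_antidiagonal_gauge]); this is the
    gauge description of functions of the first Baire class. Hence the zero set
    of a trace is a G-delta ([antidiagonal_zeros_Gdelta]), which takes
    functionally closed sets to G-delta sets. Hence also [A] is scattered when
    [E] is C*-embedded: a nonempty dense-in-itself [C] inside [A] splits into
    two pieces dense in [C] ([limit_point_resolvable]), the indicator of one
    piece would extend, and nested intervals ([baire_gauge]) produce a point
    whose value has to be close to both 0 and 1. A scattered set of reals is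
    countable and G-delta ([scattered_countable_Gdelta]).

    Sufficiency. Let [A] be countable and the intersection of open sets [G n].
    Around the [k]-th point [a] of [A] take a half-open square with corner
    [(a, - a)], of side at most [1 / (k + 1)], and so small that the points of
    the line within that side of [a] lie in [G 0], ..., [G k] and are not earlier
    points of [A]. These clopen squares form a locally finite family, so the set [S q] of the
    squares that contain [q] is a locally constant function of [q]
    ([locally_constant_slices]), while [S (x, - x)] is [{x}] or empty according
    to whether [x] is in [A]. Any function of [S q] is continuous, and this
    yields both the extension of a given function on [E] and a continuous
    function vanishing exactly on [E]. *)

(** * F-sigma and G-delta sets *)

Lemma Fsigma_bigcup (T : topologicalType) (I : countType) (D : set I)
  (F : I -> set T) :
  (forall i, D i -> Fsigma (F i)) -> Fsigma (\bigcup_(i in D) F i).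
Proof.
move=> FD.
have /choice[H HP] : forall i, exists H : (set T)^nat,
    D i -> (forall n, closed (H n)) /\ F i = \bigcup_n H n.
  move=> i; have [/FD[H cH ->]|nDi] := pselect (D i); first by exists H.
  by exists (fun=> set0) => /nDi.
exists (fun k => if unpickle k is Some (i, n) then
    if `[< D i >] then H i n else set0 else set0).
  move=> k; case: (unpickle k) => [[i n]|]; last exact: closed0.
  by case: asboolP => [/HP[cH _]|_]; [exact: cH|exact: closed0].
apply/seteqP; split => [x [i Di]|x [k _]].
  have [_ ->] := HP i Di => -[n _ Hx]; exists (pickle (i, n)) => //.
  by rewrite pickleK asboolT.
case: (unpickle k) => [[i n]|//]; case: asboolP => // Di Hx.
by exists i => //; have [_ ->] := HP i Di; exists n.
Qed.

Lemma FsigmaU (T : topologicalType) (A B : set T) :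
  Fsigma A -> Fsigma B -> Fsigma (A `|` B).
Proof.
move=> FA FB.
suff -> : A `|` B = \bigcup_(b in [set: bool]) if b then A else B.
  by apply: Fsigma_bigcup => -[].
apply/seteqP; split => [x [?|?]|x [[] _]]; [by exists true|by exists false|..].
  by left.
by right.
Qed.

Lemma FsigmaI (T : topologicalType) (A B : set T) :
  Fsigma A -> Fsigma B -> Fsigma (A `&` B).
Proof.
move=> [F cF ->] [G cG ->]; rewrite setI_bigcupl.
apply: Fsigma_bigcup => n _; rewrite setI_bigcupr.
by apply: Fsigma_bigcup => m _; apply: closed_Fsigma; exact: closedI.
Qed.

Lemma Gdelta_setC (T : topologicalType) (A : set T) :
  Fsigma (~` A) -> Gdelta A.
Proof.
move=> [F cF AF]; exists (fun n => ~` F n); first by move=> n; exact/closed_openC.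
by rewrite -setC_bigcup -AF setCK.
Qed.

Lemma GdeltaI (T : topologicalType) (A B : set T) :
  Gdelta A -> Gdelta B -> Gdelta (A `&` B).
Proof.
move=> [F oF ->] [G oG ->]; exists (fun n => F n `&` G n).
  by move=> n; exact: openI.
by rewrite bigcapI.
Qed.

Lemma Gdelta_preimage (S T : topologicalType) (g : S -> T) (A : set T) :
  continuous g -> Gdelta A -> Gdelta (g @^-1` A).
Proof.
move=> /continuousP cg [G oG ->]; exists (fun n => g @^-1` G n).
  by move=> n; exact: cg.
by rewrite preimage_bigcap.
Qed.

(** * Scattered sets of reals *)

Lemma natSinv_small (R : realType) (e : R) : 0 < e ->
  exists n, n.+1%:R^-1 < e :> R.
Proof.
move=> e0; have [n _ /(_ n (leqnn n)) ne] := near_infty_natSinv_lt (PosNum e0).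
by exists n.
Qed.

Lemma nbhs_rat_itv (R : realType) (x : R) (U : set R) : nbhs x U ->
  exists2 i : rat * rat, x \in `]ratr i.1, ratr i.2[ &
    [set` `[ratr i.1 : R, ratr i.2]] `<=` U.
Proof.
move=> /nbhs_ballP[e /= e0 xeU].
have [p] : exists p, ratr p \in `](x - e), x[ by apply: rat_in_itvoo; lra.
have [q] : exists q, ratr q \in `]x, (x + e)[ by apply: rat_in_itvoo; lra.
rewrite !in_itv /= => /andP[xq qe] /andP[ep px].
exists (p, q); first by rewrite in_itv /= px.
move=> y; rewrite /= in_itv /= => /andP[py yq]; apply: xeU.
by rewrite /ball /= ltr_norml; lra.
Qed.

Lemma open_Fsigma (R : realType) (U : set R) : open U -> Fsigma U.
Proof.
move=> oU.
pose K (i : rat * rat) : set R := [set` `[ratr i.1 : R, ratr i.2]].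
suff -> : U = \bigcup_(i in [set i | K i `<=` U]) K i.
  by apply: Fsigma_bigcup => i _; by apply: closed_Fsigma; exact: itv_closed.
apply/seteqP; split => [x Ux|x [i]]; last exact.
have [i xi iU] := @nbhs_rat_itv R x U (open_nbhs_nbhs (conj oU Ux)).
by exists i => //; rewrite /K /=; exact: subset_itv_oo_cc.
Qed.

(** The rational intervals in which the conclusion already holds have a union
    [U] in which it holds too, by countability of the base. The points of [A]
    outside [U] are none: otherwise one of them would be isolated among them, so
    some rational interval would meet [A] in [U] and that single point, and this
    interval would be part of [U]. This replaces the transfinite iteration of
    the Cantor-Bendixson derivative. *)
Lemma scattered_countable_Gdelta (R : realType) (A : set R) :
  (forall C, C `<=` A -> C `<=` limit_point C -> C = set0) ->
  countable A /\ Gdelta A.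
Proof.
move=> Asc.
pose I (i : rat * rat) : set R := [set` `]ratr i.1 : R, ratr i.2[].
pose D := [set i | countable (I i `&` A) /\ Fsigma (I i `\` A)].
pose U := \bigcup_(i in D) I i.
have oI i : open (I i) by exact: itv_open.
have oU : open U by apply: bigcup_open => i _.
have cUA : countable (U `&` A).
  rewrite setI_bigcupl; apply: bigcup_countable => [|i []//].
  exact: countableP.
have FUA : Fsigma (U `\` A).
  by rewrite setDE setI_bigcupl; apply: Fsigma_bigcup => i [_]; rewrite setDE.
suff AU : A `<=` U.
  have UA : U `&` A = A by apply/setIidPr.
  split; first by rewrite -UA.
  apply: Gdelta_setC.
  have -> : ~` A = ~` U `|` (U `\` A).
    apply/seteqP; split=> x; last by move=> [Ux /AU //|[]].
    by move=> nAx; have [Ux|nUx] := pselect (U x); [right|left].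
  by apply: FsigmaU => //; exact/closed_Fsigma/open_closedC.
rewrite -setD_eq0; apply: Asc => // a AUa.
apply: contrapT; rewrite not_limit_pointE => -[V /nbhs_rat_itv[i ai iV] VA].
have IV : I i `<=` V by apply: subset_trans iV; exact: subset_itv_oo_cc.
have IA x : I i x -> A x -> ~ U x -> x = a.
  by move=> /IV Vx Ax Ux; apply: VA.
case: AUa => Aa; apply; exists i => //; split.
  apply: (@sub_countable _ _ _ ((U `&` A) `|` [set a])).
    apply: subset_card_le => x [Ix Ax].
    by have [Ux|Ux] := pselect (U x); [left|right; exact: IA].
  rewrite -bigcup2E; apply: bigcup_countable => [|[//|[|n]] _ /=].
  - exact: countableP.
  - exact: countable1.
  - exact: countable0.
have -> : I i `\` A = (I i `&` (U `\` A)) `|` (I i `&` (~` U `&` ~` [set a])).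
  apply/seteqP; split=> x.
    move=> [Ix Ax]; have [Ux|Ux] := pselect (U x); [by left|right].
    by split=> //; split=> // xa; apply: Ax; rewrite xa.
  move=> [[Ix [_ nAx]]//|[Ix [nUx nxa]]]; split=> // Ax.
  exact/nxa/IA.
apply: FsigmaU; apply: FsigmaI => //; try exact: open_Fsigma.
apply: FsigmaI; first exact/closed_Fsigma/open_closedC.
by apply/open_Fsigma/closed_openC/accessible_closed_set1/hausdorff_accessible/Rhausdorff.
Qed.

(** Enumerate the rational intervals, each of them twice, and choose for every
    occurrence a point of [C] in that interval which was not chosen before; this
    is possible since each neighbourhood of a limit point of [C] is infinite in
    [C]. Then [B] collects the points chosen at even steps, and the points
    chosen at odd steps stay outside [B]. *)
Lemma limit_point_resolvable (R : realType) (C : set R) :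
  C `<=` limit_point C ->
  exists2 B, B `<=` C &
    forall x U, C x -> nbhs x U -> B `&` U !=set0 /\ (C `\` B) `&` U !=set0.
Proof.
move=> CC.
pose V n : set R := if unpickle n is Some (p, q) then
  [set` `]ratr p : R, ratr q[] else setT.
pose pick n (s : seq R) := xget 0 ((C `&` V n./2) `\` [set` s]).
pose L := fix L n := if n is m.+1 then pick m (L m) :: L m else [::].
(* [z n] is the point chosen at step [n], [L n] the list of the earlier ones, and
   halving [n] makes each interval [V k] occur at steps [2k] and [2k + 1]. *)
pose z n := pick n (L n).
have zL m n : (m < n)%N -> z m \in L n.
  elim: n => //= n IH; rewrite ltnS leq_eqVlt => /orP[/eqP ->|/IH zm].
    exact: mem_head.
  by rewrite inE zm orbT.
have zP n x : C x -> V n./2 x -> [/\ C (z n), V n./2 (z n) & z n \notin L n].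
  move=> Cx Vx.
  have Vnx : nbhs x (V n./2).
    move: Vx; rewrite /V; case: (unpickle _) => [[p q] Vx|_]; last exact: filterT.
    exact/open_nbhs_nbhs.
  have /limit_point_infinite_setP/(_ _ Vnx) Vinf := CC x Cx.
  have /infinite_setN0[y [[Vy Cy] Ly]] : infinite_set ((V n./2 `&` C) `\` [set` L n]).
    by apply: infinite_setD => //; exact: finite_seq.
  have [|[Cz Vz] /negP zLn] := @xgetPex _ 0 ((C `&` V n./2) `\` [set` L n]).
    by exists y.
  by split.
clearbody z L.
(* At a step whose interval misses [C], [z] is a default value, which may repeat
   an earlier point or lie outside [C]; such steps are excluded from [B]. *)
pose B := [set z n.*2 | n in [set n | C (z n.*2) /\ z n.*2 \notin L n.*2]].
exists B; first by move=> _ [n [Cz _] <-].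
move=> x U Cx /nbhs_rat_itv[[p q] xpq pqU].
have [n VE] : exists n, V n = [set` `]ratr p : R, ratr q[].
  by exists (pickle (p, q)); rewrite /V pickleK.
have VU : V n `<=` U.
  by apply: subset_trans pqU; rewrite VE; exact: subset_itv_oo_cc.
split.
  have [|] := zP n.*2 x Cx; rewrite doubleK; first by rewrite VE.
  move=> Cz Vz zL2; exists (z n.*2); split; last exact: VU.
  by exists n.
have [|] := zP n.*2.+1 x Cx; rewrite /= uphalf_double; first by rewrite VE.
move=> Cz Vz zn; exists (z n.*2.+1); split; last exact: VU.
split=> // -[m [_ zm] zE].
have [mn|nm] := ltnP m.*2 n.*2.+1; first by move: zn; rewrite -zE zL.
by move: zm; rewrite zE zL// ltn_neqAle nm andbT; lia.
Qed.

(** A form of the Baire category theorem on the closure of [C], which avoids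
    treating that closure as a space: nested closed intervals centred at points
    of [B n], of radius less than the gauge at their centre, shrink to [x]. *)
Lemma baire_gauge (R : realType) (C : set R) (B : nat -> set R) (r : R -> R) :
  C !=set0 -> (forall n, B n `<=` C) ->
  (forall n x U, C x -> nbhs x U -> B n `&` U !=set0) ->
  (forall x, 0 < r x) ->
  exists x, forall n,
    exists2 c, B n c & `|x - c| < r c /\ `|x - c| < n.+1%:R^-1.
Proof.
move=> [c0 Cc0] BC Bdense r0.
(* A pair s stands for the closed interval of centre s.1 and radius s.2. *)
have /choice[next nextP] : forall ns : nat * (R * R), exists t : R * R,
    C ns.2.1 -> 0 < ns.2.2 ->
    [/\ B ns.1 t.1, 0 < t.2, t.2 < r t.1, t.2 < ns.1.+1%:R^-1 &
      `|t.1 - ns.2.1| + t.2 <= ns.2.2].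
  move=> [n [c e]] /=.
  have [Cc|nCc] := pselect (C c); last by exists (c, e).
  have [e0|] := ltP 0 e; last by exists (c, e) => _; lra.
  have [b [Bb]] := Bdense n c _ Cc (nbhsx_ballx c e e0).
  rewrite /ball /= distrC => bc.
  pose m := Num.min (r b) (Num.min n.+1%:R^-1 (e - `|b - c|)).
  have m0 : 0 < m by rewrite !lt_min r0 invr_gt0 ltr0n subr_gt0 bc.
  have : m <= m by []; rewrite {2}/m !le_min => /and3P[mr mn me].
  move: (n.+1%:R^-1) mn => u mu.
  by exists (b, m / 2) => _ _ /=; split=> //; lra.
pose s := fix s n := if n is m.+1 then next (m, s m) else (c0, 1).
have sP n : C (s n).1 /\ 0 < (s n).2.
  elim: n => [|n [Cn n0]]; first by split; rewrite //= ltr01.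
  by have [/BC] := nextP (n, s n) Cn n0.
have stepP n : [/\ B n (s n.+1).1, (s n.+1).2 < r (s n.+1).1,
    (s n.+1).2 < n.+1%:R^-1 &
    `|(s n.+1).1 - (s n).1| + (s n.+1).2 <= (s n).2].
  by have [Cn n0] := sP n; have [] := nextP (n, s n) Cn n0.
(* The point is the supremum of the lower ends, which every upper end bounds. *)
pose lo n := (s n).1 - (s n).2; pose hi n := (s n).1 + (s n).2.
have step n : lo n <= lo n.+1 /\ hi n.+1 <= hi n.
  have [_ _ _ sub] := stepP n; rewrite /lo /hi.
  have := ler_norm ((s n.+1).1 - (s n).1).
  have := lerNnormlW (lexx `|(s n.+1).1 - (s n).1|).
  by split; lra.
have lo_hi m n : lo m <= hi n.
  have lo_incr i k : lo i <= lo (i + k)%N.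
    elim: k => [|k IH]; first by rewrite addn0.
    by rewrite addnS; have [/(le_trans IH)] := step (i + k)%N.
  have hi_decr i k : hi (i + k)%N <= hi i.
    elim: k => [|k IH]; first by rewrite addn0.
    by rewrite addnS; have [_ /le_trans->] := step (i + k)%N.
  apply: le_trans (lo_incr m n) _; apply: le_trans (hi_decr n m).
  by rewrite addnC /lo /hi; have [_] := sP (n + m)%N; lra.
pose x := sup (range lo).
have lo_x n : lo n <= x.
  by apply: sup_upper_bound; [split; [exists (lo 0%N); exists 0%N|
    exists (hi 0%N) => _ [m _ <-]]|exists n].
have x_hi n : x <= hi n.
  by apply: ge_sup; [exists (lo 0%N); exists 0%N|move=> _ [m _ <-]].
exists x => n; have [Bn nr nn _] := stepP n; exists (s n.+1).1 => //.
have /le_lt_trans xs : `|x - (s n.+1).1| <= (s n.+1).2.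
  by rewrite ler_distl; apply/andP; split; [exact: lo_x|exact: x_hi].
by split; exact: xs.
Qed.

(** * Neighbourhoods in the Sorgenfrey plane *)

Lemma sorgenfrey_plane_nbhsP (R : realType) (p : sorgenfrey_plane R)
    (U : set (sorgenfrey_plane R)) :
  nbhs p U <-> exists2 e : R, 0 < e &
    forall u v : R, p.1 <= u < p.1 + e -> p.2 <= v < p.2 + e -> U (u, v).
Proof.
case: p => x y /=; split.
  move=> [[P Q] /= [/sorgenfrey_nbhsP[b xb bP] /sorgenfrey_nbhsP[c yc cQ]] PQU].
  have := lexx (Num.min (b - x) (c - y)); rewrite le_min => /andP[eb ec].
  exists (Num.min (b - x) (c - y)); first by rewrite lt_min !subr_gt0 xb.
  move=> u v /andP[xu ub] /andP[yv vc]; apply: PQU; split => /=.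
    by apply: bP; rewrite /= in_itv /= xu /=; lra.
  by apply: cQ; rewrite /= in_itv /= yv /=; lra.
move=> [e e0 eU].
exists ([set` `[(x : R), (x : R) + e[], [set` `[(y : R), (y : R) + e[]) => /=.
  by split; apply/sorgenfrey_nbhsP; [exists (x + e : R)|exists (y + e : R)];
    rewrite ?ltrDl.
by move=> [u v] [] /=; rewrite !in_itv /=; exact: eU.
Qed.

(** Half-open intervals are clopen in the Sorgenfrey line, stated as local
    constancy of their membership test. *)
Lemma half_open_near (R : realType) (a b : R) (x : sorgenfrey R) :
  \forall u \near x, ((u : R) \in `[a, b[) = ((x : R) \in `[a, b[).
Proof.
have ge_near c : \forall u \near x, (c <= (u : R)) = (c <= (x : R)).
  apply/sorgenfrey_nbhsP; have [cx|xc] := leP c x.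
    exists (x + 1 : R); first by rewrite ltrDl.
    by move=> u /=; rewrite in_itv /= => /andP[/(le_trans cx)].
  exists c => // u; rewrite /= in_itv /= => /andP[_ uc].
  by apply/negbTE; rewrite -ltNge.
near=> u; rewrite !in_itv /= !ltNge.
by congr (_ && ~~ _); near: u; exact: ge_near.
Unshelve. all: by end_near. Qed.

Lemma continuous_coordinate_sum (R : realType) :
  continuous (fun p : sorgenfrey_plane R => (p.1 : R) + (p.2 : R)).
Proof.
have id_cont : continuous (id : sorgenfrey R -> R).
  move=> x U /nbhs_ballP[e /= e0 xeU]; apply/sorgenfrey_nbhsP.
  exists (x + e : R); first by rewrite ltrDl.
  move=> u /=; rewrite in_itv /= => xue; apply: xeU.
  by rewrite /ball /= ltr_norml; lra.
move=> p; apply: (@cvgD _ R^o).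
  by apply: (@cvg_comp _ _ _ (fst : sorgenfrey_plane R -> sorgenfrey R) id);
    [exact: cvg_fst|exact: id_cont].
by apply: (@cvg_comp _ _ _ (snd : sorgenfrey_plane R -> sorgenfrey R) id);
    [exact: cvg_snd|exact: id_cont].
Qed.

(** * Traces of continuous functions on the antidiagonal *)

(** The gauge [d x] is the side of a half-open square at [(x, - x)] on which [f]
    varies by less than [eta / 2]; if [|x - y|] is less than both sides, the two
    squares meet, and a common point compares the two values. *)
Lemma continuous_antidiagonal_gauge (R : realType) (f : sorgenfrey_plane R -> R)
    (eta : R) :
  continuous f -> 0 < eta ->
  exists2 d : R -> R, (forall x, 0 < d x) &
    forall x y, `|x - y| < d x -> `|x - y| < d y ->
      `|f (x, - x) - f (y, - y)| < eta.
Proof.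
move=> cf eta0.
have /choice[d dP] : forall x : R, exists d : R, 0 < d /\
    forall u v : R, x <= u < x + d -> - x <= v < - x + d ->
      `|f (x, - x) - f (u, v)| < eta / 2.
  move=> x; have eta20 : 0 < eta / 2 by rewrite divr_gt0.
  have /sorgenfrey_plane_nbhsP[d d0 dP] := cf (x, - x) _ (nbhsx_ballx _ _ eta20).
  by exists d; split.
exists d => [x|x y dx dy]; first by have [] := dP x.
wlog xy : x y dx dy / x <= y => [wl|].
  have [/wl|/ltW/wl] := leP x y; first exact.
  by rewrite (distrC y) (distrC (f _)); exact.
(* The half-open squares at (x, -x) and (y, -y) share the corner (y, -x). *)
rewrite ltr_norml in dx; rewrite ltr_norml in dy.
have [_ /(_ y (- x)) fx] := dP x; have [_ /(_ y (- x)) fy] := dP y.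
have {}fx : `|f (x, - x) - f (y, - x)| < eta / 2 by apply: fx; lra.
have {}fy : `|f (y, - y) - f (y, - x)| < eta / 2 by apply: fy; lra.
rewrite (splitr eta); apply: le_lt_trans (ltrD fx fy).
by rewrite (distrC (f (y, - y))) ler_distD.
Qed.

(** With a gauge [d k] for each tolerance [1 / (k + 1)], the set [G (k, n)] of the
    points that are closer than [1 / (n + 1)] and than [d k a] to some zero [a]
    is open. A point [x] in all of them is a zero: if its value exceeds
    [1 / (k + 1)], then taking [1 / (n + 1)] below [d k x] contradicts the
    gauge. The second index is what lets [n] depend on the gauge at [x]. *)
Lemma antidiagonal_zeros_Gdelta (R : realType) (f : sorgenfrey_plane R -> R) :
  continuous f -> Gdelta [set x : R | f (x, - x) = 0].
Proof.
move=> cf; set Z := [set x | _].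
have /choice[d dP] : forall k : nat, exists d : R -> R, (forall x, 0 < d x) /\
    forall x y, `|x - y| < d x -> `|x - y| < d y ->
      `|f (x, - x) - f (y, - y)| < k.+1%:R^-1.
  move=> k; have [|d d0 dP] := @continuous_antidiagonal_gauge R f k.+1%:R^-1 cf.
    by rewrite invr_gt0.
  by exists d.
pose G (i : nat * nat) : set R :=
  \bigcup_(a in Z) ball a (Num.min (d i.1 a) i.2.+1%:R^-1).
apply: Gdelta_setC.
have -> : ~` Z = \bigcup_(i in [set: nat * nat]) ~` G i.
  rewrite -setC_bigcap; congr (~` _); apply/seteqP; split=> [a Za i _|x Gx].
    exists a => //; apply: ballxx.
    by rewrite lt_min invr_gt0 ltr0n andbT; have [] := dP i.1.
  apply/eqP/negPn/negP; rewrite -normr_gt0 => /natSinv_small[k kf].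
  have [d0 dk] := dP k.
  have [n nd] := natSinv_small (d0 x).
  have [a Za] := Gx (k, n) I.
  rewrite /ball /= lt_min distrC => /andP[xa xan].
  have := dk x a (lt_trans xan nd) xa.
  by rewrite Za subr0 => /(lt_trans kf); rewrite ltxx.
apply: Fsigma_bigcup => i _; apply/closed_Fsigma/open_closedC.
by apply: bigcup_open => a _; exact: ball_open.
Qed.

Definition antidiagonal_slice (R : realType) (E : set (R * R)) : set R :=
  [set x | E (x, - x)].

Lemma antidiagonal_sliceP (R : realType) (E : set (R * R)) (p : R * R) :
  E `<=` antidiagonal R -> E p -> p.2 = - p.1 /\ antidiagonal_slice E p.1.
Proof. by move=> ED Ep; have [x _ xp] := ED p Ep; subst p. Qed.

Lemma countable_antidiagonal_slice (R : realType) (E : set (R * R)) :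
  E `<=` antidiagonal R -> countable (antidiagonal_slice E) <-> countable E.
Proof.
move=> ED; split => cE.
  have : countable [set (x, - x) | x in antidiagonal_slice E].
    exact: sub_countable (card_image_le _ _) cE.
  apply: sub_countable; apply: subset_card_le => -[x y] Exy.
  have [/= yx Ex] := antidiagonal_sliceP ED Exy.
  by exists x => //; rewrite yx.
have : countable (fst @` E) by exact: sub_countable (card_image_le _ _) cE.
by apply: sub_countable; apply: subset_card_le => x Ex; exists (x, - x).
Qed.

Lemma Gdelta_antidiagonal_slice (R : realType) (E : set (R * R)) :
  E `<=` antidiagonal R ->
  Gdelta (antidiagonal_slice E) <-> @Gdelta (euclidean_plane R) E.
Proof.
move=> ED; split => GE.
  have -> : E = (fst : euclidean_plane R -> R) @^-1` antidiagonal_slice E `&`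
      (fun p : euclidean_plane R => (p.1 : R^o) + p.2) @^-1` [set 0].
    apply/seteqP; split=> [p Ep|[x y] /= [Ex xy0]].
      have [px pE] := antidiagonal_sliceP ED Ep.
      by split=> //=; rewrite px subrr.
    by have -> : y = - x by apply/eqP; rewrite -addr_eq0 addrC; apply/eqP.
  apply: GdeltaI; apply: Gdelta_preimage => //.
  - by move=> p; exact: cvg_fst.
  - by move=> p; apply: (@cvgD _ R^o); [exact: cvg_fst|exact: cvg_snd].
  - apply/Gdelta_setC/open_Fsigma/closed_openC.
    exact/accessible_closed_set1/hausdorff_accessible/Rhausdorff.
apply: (@Gdelta_preimage _ _ (fun x : R => (x, - x) : euclidean_plane R)) GE.
by move=> x; exact: (cvg_pair (cvg_id (F := nbhs x)) (opp_continuous x)).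
Qed.

(** The unit half-open square at a point of the antidiagonal isolates that point
    in [E]. *)
Lemma continuous_within_antidiagonal (R : realType) (T : topologicalType)
    (E : set (sorgenfrey_plane R)) (f : sorgenfrey_plane R -> T) :
  E `<=` antidiagonal R -> {within E, continuous f}.
Proof.
move=> ED; apply/subspace_continuousP => p Ep U fpU.
apply/sorgenfrey_plane_nbhsP; exists 1 => // u v pu pv Euv.
have [p2 _] := antidiagonal_sliceP ED Ep.
have [/= v2 _] := antidiagonal_sliceP ED Euv.
have -> : (u, v) = p.
  case: p p2 pu pv {Ep fpU} => x y /= -> xu xv.
  have ux : u = x :> R by lra.
  by rewrite v2 ux.
exact: nbhs_singleton.
Qed.

(** The set [B] and its complement in [C] are both dense in [C]; an extension of
    the indicator of [B] would, by its gauge for [1 / 2], take at the point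
    produced by [baire_gauge] a value closer than [1 / 2] to both 0 and 1. *)
Lemma Cstar_embedded_scattered (R : realType) (E : set (R * R)) (C : set R) :
  E `<=` antidiagonal R -> Cstar_embedded R (sorgenfrey_plane R) E ->
  C `<=` antidiagonal_slice E -> C `<=` limit_point C -> C = set0.
Proof.
move=> ED CE CA CC; apply: contrapT => /eqP/set0P[c0 Cc0].
have [B BC dense] := limit_point_resolvable CC.
have [||g cg gE] := CE (fun p => if `[< B p.1 >] then 1 else 0).
- exact: continuous_within_antidiagonal.
- exists 1; split=> // M M1 p _ /=; case: ifP => _.
    by rewrite normr1 ltW.
  by rewrite normr0 (le_trans ler01)// ltW.
have gC x : C x -> g (x, - x) = if `[< B x >] then 1 else 0.
  by move=> /CA Ax; rewrite gE// inE.
have [|d d0 dP] := @continuous_antidiagonal_gauge R g 2^-1 cg.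
  by rewrite invr_gt0.
have [||||x xP] := @baire_gauge R C (fun n => if odd n then B else C `\` B) d.
- by exists c0.
- by move=> n; case: ifP => // _ y [].
- move=> n y U Cy yU; have [] := dense y U Cy yU.
  by case: ifP.
- exact: d0.
(* Step [2k] gives a point outside [B] and step [2k + 1] a point of [B], both
   closer to [x] than [1 / (k + 1)]. *)
have [k kd] := natSinv_small (d0 x).
have kn n : (k <= n)%N -> n.+1%:R^-1 < d x.
  by move=> kn; apply: le_lt_trans kd; rewrite lef_pV2 ?posrE// ler_nat ltnS.
have [a + [xa xak]] := xP k.*2.
have [b + [xb xbk]] := xP k.*2.+1.
rewrite /= odd_double /= => Bb [Ca nBa].
have ga : g (a, - a) = 0 by rewrite gC// asboolF.
have gb : g (b, - b) = 1 by rewrite gC ?asboolT//; exact: BC.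
have := dP _ _ (lt_trans xak (kn _ _)) xa; rewrite ga subr0 ltr_norml => ha.
have := dP _ _ (lt_trans xbk (kn _ _)) xb; rewrite gb ltr_norml => hb.
have {}ha : - 2^-1 < g (x, - x) < 2^-1 by apply: ha; lia.
have {}hb : - 2^-1 < g (x, - x) - 1 < 2^-1 by apply: hb; lia.
by lra.
Qed.

(** * Extension from countable G-delta sets *)

(** [S q] lists the points [a] of [A] whose clopen square contains [q]. It is
    locally constant because the squares are locally finite. Below the
    antidiagonal there are none; above it, at height [s], only squares of side
    greater than [s / 2] come near; and if a square at [a] comes near [(x, - x)],
    then [x] lies within its side of [a], hence in [G n] for all [n] up to the
    index of [a], and is not a point of [A] of smaller index, which bounds the
    index of [a] whether [x] is in [A] or not. *)
Lemma locally_constant_slices (R : realType) (A : set R) :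
  countable A -> Gdelta A ->
  exists2 S : sorgenfrey_plane R -> set R,
    forall p, \forall q \near p, S q = S p &
    forall x, S (x, - x) = A `&` [set x].
Proof.
move=> /countable_injP[idx idx_inj] [G oG AG].
(* [avoids a x] must hold for every [x] within the side [e a] of [a]; it fails for
   each fixed [x] when the index of [a] is large. *)
pose avoids a x := (forall n, (n <= idx a)%N -> G n x) /\
  (forall b, A b -> (idx b < idx a)%N -> x <> b).
have /choice[e eP] : forall a : R, exists e : R, [/\ 0 < e, e <= (idx a).+1%:R^-1 &
    A a -> forall x, `|a - x| < e -> avoids a x].
  move=> a; have u0 : 0 < (idx a).+1%:R^-1 :> R by rewrite invr_gt0.
  have [Aa|nAa] := pselect (A a); last by exists (idx a).+1%:R^-1; split.
  pose P (n : 'I_(idx a).+1) : set R := [set x | G n x /\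
    forall b, A b -> idx b = n -> (n < idx a)%N -> x <> b].
  have : \forall x \near a, forall n, P n x.
    apply: (@filter_forall _ _ P (nbhs a)) => n; apply/near_andP; split.
      by apply: open_nbhs_nbhs; split=> //; move: Aa; rewrite AG; exact.
    have [[b [Ab bn na]]|none] :=
        pselect (exists b, [/\ A b, idx b = n & (n < idx a)%N]); last first.
      by apply: nearW => x b Ab bn na; case: none; exists b.
    have : \forall x \near a, ~ [set b] x.
      apply: open_nbhs_nbhs; split.
        exact/closed_openC/accessible_closed_set1/hausdorff_accessible/Rhausdorff.
      by move=> /= ab; move: na; rewrite -bn ab ltnn.
    apply: filterS => x xb c Ac cn _ xc; apply: xb => /=; rewrite xc.
    by apply: idx_inj; rewrite ?inE// cn.
  move=> /nbhs_ballP[e /= e0 ea].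
  exists (Num.min e (idx a).+1%:R^-1); split=> [||_ x].
  - by rewrite lt_min e0.
  - by rewrite ge_min lexx orbT.
  - rewrite lt_min => /andP[/ea ax _]; split=> [n na|b Ab ba].
      by have [] := ax (Ordinal (na : (n < (idx a).+1)%N)).
    have [_ axb] := ax (Ordinal (leqW ba : (idx b < (idx a).+1)%N)).
    exact: axb.
pose W (a : R) (q : sorgenfrey_plane R) : bool :=
  ((q.1 : R) \in `[a, (a + e a)[) && ((q.2 : R) \in `[(- a), (- a + e a)[).
have WP a q : W a q = (a <= q.1 < a + e a) && (- a <= q.2 < - a + e a).
  by rewrite /W !in_itv.
exists (fun q => [set a | A a /\ W a q]); last first.
  move=> x; apply/seteqP; split=> [a [Aa]|a [Aa /= ax]].
    by rewrite WP /= => ?; split=> //=; lra.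
  by subst a; split=> //; rewrite WP /= !lexx !ltrDl; have [->] := eP x.
move=> p.
have [n few] : exists n, \forall q \near p, forall a, A a -> (n <= idx a)%N -> ~~ W a q.
  have local (P : sorgenfrey_plane R -> Prop) d : 0 < d ->
      (forall u v : R, p.1 <= u < p.1 + d -> p.2 <= v < p.2 + d -> P (u, v)) ->
      \forall q \near p, P q.
    by move=> d0 dP; apply/sorgenfrey_plane_nbhsP; exists d.
  have [neg|pos|diag] := ltgtP (p.1 + p.2 : R) 0.
  - exists 0%N; apply: (local _ (- (p.1 + p.2) / 2)); first by lra.
    by move=> u v pu pv a _ _; rewrite WP /=; apply/negP; lra.
  - have [n np] := natSinv_small (divr_gt0 pos (ltr0n _ 2)).
    exists n; apply: (local _ 1) => // u v pu pv a _ na.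
    have [_ ea _] := eP a.
    have : (idx a).+1%:R^-1 <= n.+1%:R^-1 :> R.
      by rewrite lef_pV2 ?posrE// ler_nat ltnS.
    move: ea np; move: (_^-1) (_^-1) => s t; rewrite WP /=.
    by move=> *; apply/negP; lra.
  - have [n nP] : exists n, forall a, A a -> (n <= idx a)%N -> ~ avoids a p.1.
      have [Ap|] := pselect (A p.1).
        exists (idx p.1).+1 => a Aa pa [_ /(_ _ Ap pa)]; exact.
      rewrite {1}AG => /existsNP[n /not_implyP[_ nG]].
      by exists n => a Aa na [/(_ n na)].
    exists n; apply: (local _ 1) => // u v pu pv a Aa na; rewrite WP /=.
    apply/negP => aW; apply: (nP a Aa na); have [_ _] := eP a; apply=> //.
    by rewrite ltr_norml; lra.
pose same (i : 'I_n) : set (sorgenfrey_plane R) :=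
  [set q | forall a, A a -> idx a = i -> W a q = W a p].
(* Only finitely many squares remain near [p], and each of them is clopen. *)
have near_same : \forall q \near p, forall i, same i q.
  apply: (@filter_forall _ _ same (nbhs p)) => i.
  have [[b [Ab bi]]|none] := pselect (exists b, A b /\ idx b = i); last first.
    by apply: nearW => q a Aa ai; case: none; exists a.
  have Wb : \forall q \near p, W b q = W b p.
    have Wb1 : \forall q \near p, ((q.1 : R) \in `[b, (b + e b)[) =
        ((p.1 : R) \in `[b, (b + e b)[).
      exact: (cvg_fst (half_open_near b (b + e b) p.1)).
    have Wb2 : \forall q \near p, ((q.2 : R) \in `[(- b), (- b + e b)[) =
        ((p.2 : R) \in `[(- b), (- b + e b)[).
      exact: (cvg_snd (half_open_near (- b) (- b + e b) p.2)).
    by apply: filterS2 Wb1 Wb2 => q; rewrite /W => -> ->.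
  apply: filterS Wb => q Wbq a Aa ai.
  by have -> : a = b by apply: idx_inj; rewrite ?inE// ai bi.
have fewp := nbhs_singleton few.
apply: filterS2 few near_same => q fewq sameq; apply/seteqP.
suff Wpq a : A a -> W a q = W a p.
  by split=> a [Aa Wa]; split=> //; move: Wa; rewrite Wpq.
move=> Aa; have [na|an] := leqP n (idx a).
  by rewrite (negbTE (fewq a Aa na)) (negbTE (fewp a Aa na)).
exact: (sameq (Ordinal an)).
Qed.

(** The function [|u + v|], truncated at 1, vanishes exactly on the antidiagonal,
    which the union of the squares meets in [E]. That union is clopen, so the
    value 1 can be given outside it. *)
Lemma countable_Gdelta_functionally_closed (R : realType) (E : set (R * R)) :
  E `<=` antidiagonal R -> countable (antidiagonal_slice E) ->
  Gdelta (antidiagonal_slice E) ->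
  functionally_closed R (sorgenfrey_plane R) E.
Proof.
move=> ED cA GA; have [S Sloc Sdiag] := locally_constant_slices cA GA.
pose h (p : sorgenfrey_plane R) : R := Num.min 1 `|(p.1 : R) + (p.2 : R)|.
have ch : continuous h.
  move=> p; apply: (@continuous_min R _ (cst 1)
    (fun p : sorgenfrey_plane R => `|(p.1 : R) + (p.2 : R)|)).
    exact: cvg_cst.
  by apply: (@cvg_norm _ R^o); exact: continuous_coordinate_sum.
exists (fun p => if `[< S p = set0 >] then 1 else h p); split.
- move=> p.
  have near_eq : \forall q \near p,
      (if `[< S p = set0 >] then 1 else h q) =
      (if `[< S q = set0 >] then 1 else h q).
    by apply: filterS (Sloc p) => q ->.
  apply: cvg_trans (near_eq_cvg near_eq) _.
  by case: ifP => _; [exact: cvg_cst|exact: ch].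
- move=> _ [p _ <-] /=; rewrite in_itv /=; case: ifP => _.
    by rewrite ler01 lexx.
  by rewrite /h le_min ler01 normr_ge0 ge_min lexx.
- apply/seteqP; split=> [p Ep|[x y] /=].
    have [p2 Ap] := antidiagonal_sliceP ED Ep.
    rewrite /= asboolF; first by rewrite /h p2 subrr normr0 min_r.
    have -> : p = (p.1, - p.1) by rewrite -p2; case: (p).
    rewrite Sdiag => /seteqP[+ _] => /(_ p.1); exact.
  case: asboolP => [_ /eqP|Sxy hxy]; first by rewrite oner_eq0.
  have yx : y = - x.
    move: hxy; rewrite /h /= minElt; case: ifP => _ /eqP; rewrite ?oner_eq0//.
    by rewrite normr_eq0 addrC addr_eq0 => /eqP.
  apply: contrapT => nE; apply: Sxy; rewrite yx Sdiag.
  by apply/seteqP; split=> // z [+ /= zx]; rewrite zx /antidiagonal_slice /= -yx.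
Qed.

(** The extension takes at [q] the value of [f] at the corner of one of the
    squares that contain [q], chosen as a function of [S q] only. *)
Lemma countable_Gdelta_C_embedded (R : realType) (E : set (R * R)) :
  E `<=` antidiagonal R -> countable (antidiagonal_slice E) ->
  Gdelta (antidiagonal_slice E) ->
  C_embedded R (sorgenfrey_plane R) E.
Proof.
move=> ED cA GA f _; have [S Sloc Sdiag] := locally_constant_slices cA GA.
exists (fun p => let x := xget 0 (S p) in f (x, - x)).
  move=> p.
  have near_eq : \forall q \near p,
      (let x := xget 0 (S p) in f (x, - x)) = (let x := xget 0 (S q) in f (x, - x)).
    by apply: filterS (Sloc p) => q ->.
  apply: cvg_trans (near_eq_cvg near_eq) _; exact: cvg_cst.
move=> p /set_mem Ep; have [p2 Ap] := antidiagonal_sliceP ED Ep.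
have pE : p = (p.1, - p.1) by rewrite -p2; case: (p).
have Sp : S p = [set p.1].
  by rewrite pE Sdiag /=; apply/setIidPr => x ->.
have xp : xget 0 (S p) = p.1 by apply: xget_subset1; rewrite Sp // => y z -> ->.
by rewrite /= xp -pE.
Qed.

(** * Characterization of embedded subsets of the antidiagonal *)

Theorem theorem5p1 (R : realType) (E : set (R * R)) :
  E `<=` antidiagonal R ->
  [<-> C_embedded R (sorgenfrey_plane R) E;
       Cstar_embedded R (sorgenfrey_plane R) E;
       countable E /\ @Gdelta (euclidean_plane R) E;
       countable E /\ functionally_closed R (sorgenfrey_plane R) E].
Proof.
move=> ED; tfae.
- by move=> CE f cf _; exact: CE.
- move=> CE.
  have [cA GA] := scattered_countable_Gdelta
    (fun C => Cstar_embedded_scattered ED CE (C := C)).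
  by split; [apply/countable_antidiagonal_slice|apply/Gdelta_antidiagonal_slice].
- move=> [cE GE]; split=> //; apply: countable_Gdelta_functionally_closed => //.
    exact/countable_antidiagonal_slice.
  exact/Gdelta_antidiagonal_slice.
- move=> [cE [f [cf _ Ef]]]; apply: countable_Gdelta_C_embedded => //.
    exact/countable_antidiagonal_slice.
  have -> : antidiagonal_slice E = [set x | f (x, - x) = 0].
    by rewrite /antidiagonal_slice Ef.
  exact: antidiagonal_zeros_Gdelta.
Qed.
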